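(* Let $\mathcal{F}$ be a countable class of measurable functions $f:\Omega\to\mathbb{R}$, and let $$V=V(x)=\mathbb{E}_y\sup_{f\in\mathcal{F}}\sum_{i=1}^n\bigl(f(x_i)-f(y_i)\bigr)^2 .$$ Then for any $\alpha>0$ and all $t\ge 0$, $$\mathbb{P}\Bigl(\sup_{f\in\mathcal{F}}\sum_{i=1}^n f(x_i)\ge\mathbb{E}\sup_{f\in\mathcal{F}}\sum_{i=1}^n f(x_i)+2\sqrt{Vt}\Bigr)\le 2^{\alpha+1}\exp\Bigl\{1-\frac{\alpha}{\alpha+1}t\Bigr\}$$ and $$\mathbb{P}\Bigl(\sup_{f\in\mathcal{F}}\sum_{i=1}^n f(x_i)\le\mathbb{E}\sup_{f\in\mathcal{F}}\sum_{i=1}^n f(x_i)-2\sqrt{Vt}\Bigr)\le 2^{\alpha+1}\exp\Bigl\{1-\frac{\alpha}{\alpha+1}t\Bigr\}.$$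
   Context: $(\Omega,\mu)$ is a probability space and $n\ge1$. The points $x=(x_1,\dots,x_n)$ and $y=(y_1,\dots,y_n)$ are independent, each with law $\mu^n$ on the product space $\Omega^n$; $\mathbb{P}$ and $\mathbb{E}$ refer to the law of $x$, and $\mathbb{E}_y$ is expectation over $y$ with $x$ fixed. Thus $V$ is a function of $x$.
   Formalization: The supremum of sums is assumed integrable, so its expectation is finite, and points where V = 0 and the supremum equals its expectation are removed from both events; otherwise the claim fails, e.g. for the class {0} and large t. *)

(* Defs.v *)
From HB Require Import structures.
From mathcomp Require Import all_boot all_order all_algebra.
From mathcomp Require Import all_classical all_reals all_analysis.

Set Implicit Arguments.
Unset Strict Implicit.
Unset Printing Implicit Defensive.

Import Order.TTheory GRing.Theory Num.Theory.

Local Open Scope classical_set_scope.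
Local Open Scope ring_scope.
Local Open Scope ereal_scope.

Section power_probability.
Context d (T : measurableType d) (R : realType) (P : probability T R).

Definition tuple_cons n (z : T * n.-tuple T) : n.+1.-tuple T :=
  [tuple of z.1 :: z.2].

Lemma measurable_tuple_cons n : measurable_fun setT (@tuple_cons n).
Proof. exact: measurable_cons. Qed.

HB.instance Definition _ n := isMeasurableFun.Build _ _ _ _
  (@tuple_cons n) (@measurable_tuple_cons n).

(* The [n]-fold product probability on [n.-tuple T], whose canonical
   sigma-algebra is the one generated by the coordinates; it is characterized
   by [power_probability_rect] below. *)
Fixpoint power_probability n : probability (n.-tuple T) R :=
  match n with
  | 0 => \d_([tuple])
  | m.+1 => distribution (P \x power_probability m)
                         [the {mfun _ >-> _} of @tuple_cons m]
  end.

Lemma power_probability_rect n (A : 'I_n -> set T) :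
  (forall i, measurable (A i)) ->
  power_probability n [set x | forall i, A i (tnth x i)] =
  \prod_(i < n) P (A i).
Proof.
elim: n A => [A _|n IH A mA].
  rewrite big_ord0 /= diracE mem_set//.
  by case.
rewrite big_ord_recl /= /distribution /pushforward -IH; last by [].
have -> : @tuple_cons n @^-1` [set x | forall i, A i (tnth x i)] =
    A ord0 `*` [set x | forall i, A (lift ord0 i) (tnth x i)].
  apply/seteqP; split => [[a x] /= h|[a x] /= [h0 h] i].
    by split => [|i]; [exact: (h ord0)|have := h (lift ord0 i); rewrite tnthS].
  by case: (unliftP ord0 i) => [j ->|->]; rewrite ?tnthS//; exact: h.
rewrite product_measure1E//.
have -> : [set x : n.-tuple T | forall i, A (lift ord0 i) (tnth x i)] =
    \bigcap_(i in [set: 'I_n]) ((fun x => tnth x i) @^-1` A (lift ord0 i)).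
  by apply/seteqP; split => x /= h i => [_|]; exact: h.
apply: fin_bigcap_measurable => // i _.
by rewrite -[X in measurable X]setTI; exact: measurable_tnth.
Qed.

End power_probability.

Section suprema.
Context d (T : measurableType d) (R : realType) (P : probability T R).
Context (F : set (T -> R)) (n : nat).

Definition sup_sum (x : n.-tuple T) : \bar R :=
  ereal_sup [set (\sum_(i < n) f (tnth x i))%:E | f in F].

(* The inner supremum is taken in the extended reals, so [cond_var x = +oo] is
   allowed. *)
Definition cond_var (x : n.-tuple T) : \bar R :=
  \int[power_probability P n]_y
    ereal_sup [set (\sum_(i < n) (f (tnth x i) - f (tnth y i)) ^+ 2)%:E
              | f in F].

End suprema.

(* Main.v *)
Require Import Defs.
From mathcomp Require Import all_boot all_order all_algebra.
From mathcomp Require Import all_classical all_reals all_analysis.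
From mathcomp Require Import measurable_realfun.
From mathcomp Require Import ring lra.

Import Order.TTheory GRing.Theory Num.Theory.
Import numFieldNormedType.Exports.

Local Open Scope classical_set_scope.
Local Open Scope ring_scope.

(** Write [Z x] for the supremum of the empirical sums and [W x y] for the
    supremum over [F] of the squared distances of the values at [x] and [y], so
    that [V x] is the mean of [W x y] over [y]. The proof is by symmetrization:
    [Z x] is first compared with [Z y] for an independent copy [y], and the mean
    of [Z] enters only at the end, through a convexity argument.

    Fix [x] and [y]. Exchanging [x_i] and [y_i] on the coordinates chosen by a
    sign vector [e] leaves [W x y] unchanged and turns [Z x] into a function
    [G e] on the discrete cube, which is a supremum of affine forms whose
    gradients have squared length at most [w = W x y]. Under the uniform law of
    [e], such a function satisfies
    [E exp(l G) * E exp(- l G) <= exp(l^2 w / 2)]. This is the convex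
    concentration of Talagrand and Maurey, proved in [cube_sum_expR_le] by
    induction on the dimension from an inequality on two points. The exchange
    turns [Z y] into [G] at the opposite vertex, so the Cauchy-Schwarz
    inequality and Chernoff's bound show, for [w > 0], that the difference of
    the two is at least [2 sqrt(s w)] with probability at most [exp(- s)]. Let
    [nu x y = max(0, Z x - Z y)^2 / (4 W x y)]; summing this tail, the mean of
    [max(0, nu - c)] over all exchanges is at most [exp(- c)]. The law of
    [(x, y)] is invariant under exchanges ([ge0_integral_pick_tuple]), hence the
    mean of [max(0, nu x y - c)] over [x] and [y] is at most [exp(- c)] as well
    ([integral_excess_le]).

    The passage from [Z y] to its mean rests on the identity
    [u^2 / (4 v) = sup_delta (delta u - delta^2 v)] for [u >= 0] and [v > 0], the
    supremum being over [delta >= 0], which presents the ratio as a supremum of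
    linear functions of [(u, v)]. At a point [x] of the upper
    event some [delta > 0] satisfies [t <= delta (Z x - EZ) - delta^2 V x]; the
    right-hand side is the mean over [y] of
    [delta (Z x - Z y) - delta^2 W x y <= nu x y], so the mean over [y] of
    [max(0, nu x y - (t - 1))] is at least [1]. Integrating over [x] bounds the
    probability of the event by [exp(1 - t)] when [1 <= t]. The lower event is
    treated in the same way with [x] and [y] exchanged. For every [alpha > 0],
    the announced bound is at least [exp(1 - t)], which in turn is at least [1]
    when [t < 1]. *)

(** * Exponential inequalities on two points *)

Section real_inequalities.
Context {R : realType}.
Implicit Types x y r d : R.

Lemma ge0_is_derive_ndecr (f df : R -> R) :
  (forall x, is_derive x 1 f (df x)) -> (forall x, 0 <= x -> 0 <= df x) ->
  forall x, 0 <= x -> f 0 <= f x.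
Proof.
move=> fdf df0 x x0.
apply: (@ger0_derive1_le_cc _ f 0 x) => //; rewrite ?in_itv/= ?lexx ?x0//.
- by move=> z; rewrite in_itv/= => /andP[z0 _];
    rewrite derive1E; have [_ ->] := fdf z; exact/df0/ltW.
- apply: derivable_within_continuous => z _; by have [] := fdf z.
Qed.

Let is_derive_expRN x : is_derive x 1 (fun z : R => expR (- z)) (- expR (- x)).
Proof.
have := is_derive1_comp (is_derive_expR (- x)) (is_deriveNid x 1).
by rewrite mulrN1.
Qed.

(** The derivative of the difference of the two sides is [z (e^z - e^-z)], which
    is nonnegative for [0 <= z]. *)
Lemma sinh_le_mul_cosh x : 0 <= x ->
  expR x - expR (- x) <= x * (expR x + expR (- x)).
Proof.
move=> x0; rewrite -subr_ge0.
pose f (z : R) := z * (expR z + expR (- z)) - (expR z - expR (- z)).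
have -> : 0 = f 0 by rewrite /f oppr0 mul0r subrr subr0.
apply: (@ge0_is_derive_ndecr f (fun z => z * (expR z - expR (- z)))) => // z.
  by rewrite /f; apply: is_derive_eq; rewrite /GRing.scale/=; ring.
move=> z0; rewrite mulr_ge0// subr_ge0 ler_expR; lra.
Qed.

(** By [sinh_le_mul_cosh], the quotient of the two sides is nonincreasing. *)
Lemma cosh_le_expR x : 0 <= x -> expR x + expR (- x) <= 2 * expR (x ^+ 2 / 2).
Proof.
move=> x0.
pose f (z : R) := 2 - expR (- (z ^+ 2 / 2)) * (expR z + expR (- z)).
have : f 0 <= f x.
  pose df (z : R) := expR (- (z ^+ 2 / 2)) *
    (z * (expR z + expR (- z)) - (expR z - expR (- z))).
  apply: (@ge0_is_derive_ndecr f df) => // z; last first.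
    by move=> z0; rewrite mulr_ge0 ?expR_ge0// subr_ge0 sinh_le_mul_cosh.
  have dg : is_derive z 1 (fun z : R => expR (- (z ^+ 2 / 2)))
      (- z * expR (- (z ^+ 2 / 2))).
    have dh : is_derive z 1 (fun z : R => - (z ^+ 2 / 2)) (- z).
      by apply: is_derive_eq; rewrite /GRing.scale/=; lra.
    have := @is_derive1_comp _ expR _ _ _ _ (is_derive_expR _) dh.
    by rewrite mulrC.
  rewrite /f; apply: is_derive_eq.
  rewrite /df /GRing.scale/=; ring.
rewrite /f expr0n/= mul0r oppr0 expR0 mul1r subrr subr_ge0 => h.
rewrite -ler_pdivrMr ?expR_gt0// -expRN mulrC//.
Qed.

(** The left-hand side is [4 cosh(p) cosh(q) exp(- q^2)] with [q = d / 2] and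
    [0 <= p <= q], so the Gaussian bound on both factors suffices. *)
Lemma two_point_sum_le d : 0 <= d -> d <= 1 ->
  (1 + expR (d - d ^+ 2 / 2)) * (1 + expR (- d)) <= 4.
Proof.
move=> d0 d1.
have [p pE] : exists p, p = d / 2 - d ^+ 2 / 4 by exists (d / 2 - d ^+ 2 / 4).
have [q qE] : exists q, q = d / 2 by exists (d / 2).
have p0 : 0 <= p by rewrite pE; nra.
have q0 : 0 <= q by rewrite qE; lra.
have -> : (1 + expR (d - d ^+ 2 / 2)) * (1 + expR (- d)) =
    (expR p + expR (- p)) * (expR q + expR (- q)) * expR (- (d ^+ 2 / 4)).
  have -> : d - d ^+ 2 / 2 = p + p by rewrite pE; lra.
  have -> : - d = - q - q by rewrite qE; lra.
  have -> : - (d ^+ 2 / 4) = p - q by rewrite pE qE; lra.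
  rewrite !expRD !expRN; field.
  by rewrite !gt_eqF ?expR_gt0.
have h : (expR p + expR (- p)) * (expR q + expR (- q)) <=
    (2 * expR (p ^+ 2 / 2)) * (2 * expR (q ^+ 2 / 2)).
  by apply: ler_pM; rewrite ?addr_ge0 ?expR_ge0 ?cosh_le_expR.
apply: (@le_trans _ _
    (2 * expR (p ^+ 2 / 2) * (2 * expR (q ^+ 2 / 2)) * expR (- (d ^+ 2 / 4)))).
  by rewrite ler_wpM2r ?expR_ge0.
rewrite mulrACA -!mulrA -!expRD.
have -> : 4 = 2 * (2 * 1) :> R by lra.
rewrite !ler_wpM2l// -[leRHS]expR0 ler_expR.
have : p ^+ 2 <= q ^+ 2 by rewrite ler_sqr ?nnegrE// pE qE; nra.
rewrite qE; nra.
Qed.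

(** Induction step of the concentration inequality in the last dimension: the
    numbers [exp x] and [exp y] are the sums of [exp(- g)] over the two facets of
    a cube, and [H0], [H1] are the sums of the dual exponentials over the same
    facets. The interpolation parameter [r] may be chosen for each facet: the
    facet with the larger sum takes [r = 0], the other one takes
    [r = min(1, x - y)], which minimizes [r^2 / 2 + (1 - r) (x - y)]. *)
Lemma two_point_interpolation (K x y H0 H1 : R) : 0 <= K ->
  (forall r, 0 <= r <= 1 -> H0 <= K * expR (r ^+ 2 / 2 - ((1 - r) * x + r * y))) ->
  (forall r, 0 <= r <= 1 -> H1 <= K * expR (r ^+ 2 / 2 - ((1 - r) * y + r * x))) ->
  (H0 + H1) * (expR x + expR y) <= 4 * K.
Proof.
move=> K0.
wlog xy : x y H0 H1 / y <= x => [wl|].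
  case: (leP y x) => [|/ltW] xy h0 h1; first exact: wl.
  by rewrite [H0 + _]addrC [expR x + _]addrC; exact: wl.
move=> h0 h1.
have {}h0 : H0 <= K * expR (- x).
  have := h0 0; rewrite lexx ler01 => /(_ isT).
  by rewrite !mul0r expr0n/= mul0r subr0 mul1r add0r addr0.
have {}h1 r : 0 <= r <= 1 ->
    H1 <= K * expR (- x) * expR (r ^+ 2 / 2 + (1 - r) * (x - y)).
  move=> /h1; congr (_ <= _); rewrite -mulrA -expRD; congr (_ * expR _); ring.
have hb B : 0 <= B -> H1 <= K * expR (- x) * B ->
    (1 + B) * (1 + expR (- (x - y))) <= 4 ->
    (H0 + H1) * (expR x + expR y) <= 4 * K.
  move=> B0 hB h4.
  have ey : expR y = expR x * expR (- (x - y)) by rewrite -expRD; congr expR; ring.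
  apply: (@le_trans _ _ ((K * expR (- x) * (1 + B)) * (expR x + expR y))).
    rewrite ler_wpM2r ?addr_ge0 ?expR_ge0//; lra.
  have -> : K * expR (- x) * (1 + B) * (expR x + expR y) =
      K * ((1 + B) * (1 + expR (- (x - y)))).
    rewrite ey expRN; field; by rewrite gt_eqF ?expR_gt0.
  by rewrite mulrC ler_wpM2r.
have [d1|d1] := leP (x - y) 1.
  apply: (hb (expR ((x - y) - (x - y) ^+ 2 / 2))); first exact: expR_ge0.
    have := h1 (x - y); rewrite subr_ge0 xy d1 => /(_ isT).
    congr (_ <= _ * expR _); lra.
  by apply: (two_point_sum_le (x - y)); rewrite ?subr_ge0.
apply: (hb (expR (1 - 1 ^+ 2 / 2))); first exact: expR_ge0.
  have := h1 1; rewrite lexx ler01 => /(_ isT).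
  congr (_ <= _ * expR _); lra.
apply: le_trans (two_point_sum_le 1 ler01 (lexx 1)).
rewrite ler_wpM2l ?addr_ge0 ?expR_ge0// lerD2l ler_expR lerN2; exact: ltW.
Qed.

End real_inequalities.

(** * Convex concentration on the discrete cube *)

Section cube.
Context {R : realType}.

(** Convexity of [expR], from its tangent line at the mixture. *)
Lemma expR_mix_le (r a b : R) : 0 <= r <= 1 ->
  expR ((1 - r) * a + r * b) <= (1 - r) * expR a + r * expR b.
Proof.
move=> /andP[r0 r1]; set m := (1 - r) * a + r * b.
have h z : expR m * (1 + (z - m)) <= expR z.
  by rewrite -[in leRHS](subrKC m z) [in leRHS]expRD ler_wpM2l ?expR_ge0//
    expR_ge1Dx.
have -> : expR m =
    (1 - r) * (expR m * (1 + (a - m))) + r * (expR m * (1 + (b - m))).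
  by rewrite /m; ring.
by rewrite lerD// ler_wpM2l ?subr_ge0.
Qed.

(** Hoelder's inequality with exponents [1 / (1 - r)] and [1 / r], including the
    endpoints [r = 0] and [r = 1]. Writing the two bounds as [K e^-x] and [K e^-y]
    reduces it to the pointwise convexity of [expR]. *)
Lemma sum_expR_mix_le (I : finType) (A B : I -> R) (K x y r : R) :
  0 <= r <= 1 ->
  \sum_i expR (A i) <= K * expR (- x) -> \sum_i expR (B i) <= K * expR (- y) ->
  \sum_i expR ((1 - r) * A i + r * B i) <= K * expR (- ((1 - r) * x + r * y)).
Proof.
move=> r01 hA hB; have /andP[r0 r1] := r01.
have shift (C : I -> R) z : \sum_i expR (C i) <= K * expR (- z) ->
    \sum_i expR (C i + z) <= K.
  rewrite expRN ler_pdivlMr ?expR_gt0// mulr_suml.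
  by under eq_bigr do rewrite -expRD.
rewrite expRN ler_pdivlMr ?expR_gt0// mulr_suml.
apply: (@le_trans _ _ (\sum_i ((1 - r) * expR (A i + x) + r * expR (B i + y)))).
  apply: ler_sum => i _; apply: le_trans (expR_mix_le _ _ _ r01).
  rewrite -expRD ler_expR; lra.
rewrite big_split/= -!mulr_sumr.
have -> : K = (1 - r) * K + r * K by ring.
by rewrite lerD// ler_wpM2l ?subr_ge0// shift.
Qed.

Lemma sum_tuple_cons n (h : n.+1.-tuple bool -> R) :
  \sum_e h e = \sum_(e : n.-tuple bool) h [tuple of true :: e] +
    \sum_(e : n.-tuple bool) h [tuple of false :: e].
Proof.
rewrite (reindex (fun p : bool * n.-tuple bool => [tuple of p.1 :: p.2]))/=.
  rewrite -(pair_bigA _ (fun b (e : n.-tuple bool) => h [tuple of b :: e]))/=.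
  by rewrite big_bool.
exists (fun e => (thead e, [tuple of behead e])) => [[b e] _|e _] /=.
  by rewrite theadE; congr pair; apply/val_inj.
by rewrite [RHS]tuple_eta.
Qed.

(** Here [u e] and [a e] are the value at [e] and the slope of an affine minorant
    of [g] on the cube. If [g] is a supremum of affine forms, any selection of
    (almost) maximizing forms qualifies. Then [u e - |a e|^2 / 2] is below the
    infimum over [e'] of [g e' + |e - e'|^2 / 2], taken over the solid cube, for
    the convex extension of [g]. The inequality thus is a form of Maurey's
    property for the uniform law on the cube. Stated for minorants, it passes to
    facets: a minorant selected at a vertex of one facet restricts to both
    facets. The induction splits off the first coordinate, and mixes the two
    restrictions with weight [r] by Hoelder's inequality. *)
Lemma cube_sum_expR_le n (a : n.-tuple bool -> 'I_n -> R)
    (u g : n.-tuple bool -> R) :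
  (forall e e' : n.-tuple bool,
    u e + \sum_i a e i * ((tnth e' i)%:R - (tnth e i)%:R) <= g e') ->
  (\sum_e expR (u e - (\sum_i a e i ^+ 2) / 2)) * (\sum_e expR (- g e)) <=
  4 ^+ n.
Proof.
elim: n a u g => [|n IH] a u g ug.
  have tup0 (h : 0.-tuple bool -> R) : \sum_e h e = h [tuple].
    rewrite (big_pred1 [tuple])// => e; exact/esym/eqP/tuple0.
  rewrite !tup0 big_ord0 mul0r subr0 expr0 -expRD -[leRHS]expR0 ler_expR subr_le0.
  by have := ug [tuple] [tuple]; rewrite big_ord0 addr0.
pose X b : R := \sum_(e : n.-tuple bool) expR (- g [tuple of b :: e]).
have X0 b : 0 < X b.
  rewrite /X (bigD1 [tuple of nseq n true])//=.
  by rewrite ltr_wpDr ?expR_gt0// sumr_ge0// => *; exact: expR_ge0.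
pose tl b (e : n.-tuple bool) : R :=
  (\sum_i a [tuple of b :: e] (lift ord0 i) ^+ 2) / 2.
pose a0 b (e : n.-tuple bool) : R := a [tuple of b :: e] ord0.
(* The minorant selected at the vertex e of the facet b, restricted to the
   facet b'. *)
pose A (b b' : bool) (e : n.-tuple bool) : R :=
  u [tuple of b :: e] + a0 b e * (b'%:R - b%:R) - tl b e.
have SX (b b' : bool) : \sum_e expR (A b b' e) <= 4 ^+ n * expR (- ln (X b')).
  rewrite expRN lnK ?posrE// ler_pdivlMr//.
  apply: IH => e e'; have := ug [tuple of b :: e] [tuple of b' :: e'].
  rewrite big_ord_recl/= addrA !tnth0; congr (_ + _ <= _).
  by apply: eq_bigr => i _; rewrite !tnthS.
pose H b : R := \sum_(e : n.-tuple bool)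
  expR (u [tuple of b :: e] - (a0 b e ^+ 2 / 2 + tl b e)).
have HX b (r : R) : 0 <= r <= 1 -> H b <= 4 ^+ n *
    expR (r ^+ 2 / 2 - ((1 - r) * ln (X b) + r * ln (X (~~ b)))).
  move=> r01.
  rewrite expRD mulrCA; apply: (@le_trans _ _ (expR (r ^+ 2 / 2) *
     (\sum_e expR ((1 - r) * A b b e + r * A b (~~ b) e)))); last first.
    by rewrite ler_wpM2l ?expR_ge0//; exact: sum_expR_mix_le.
  rewrite mulr_sumr; apply: ler_sum => e _; rewrite -expRD ler_expR /A.
  (* Passing to the opposite facet changes the minorant by a0 or by - a0, and
     r * a0 <= r^2 / 2 + a0^2 / 2 in absolute value. *)
  have : 0 <= (a0 b e + r) ^+ 2 by exact: sqr_ge0.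
  have : 0 <= (a0 b e - r) ^+ 2 by exact: sqr_ge0.
  by case: b => /=; nra.
have := @two_point_interpolation R (4 ^+ n) (ln (X true)) (ln (X false))
  (H true) (H false).
rewrite exprn_ge0// !lnK ?posrE// exprS => /(_ isT (HX true) (HX false)).
congr (_ * _ <= _); last by rewrite [RHS]sum_tuple_cons.
rewrite [RHS]sum_tuple_cons; congr (_ + _); apply: eq_bigr => e _;
  by rewrite big_ord_recl mulrDl.
Qed.

End cube.

(** * Exponential tails and exchanges of coordinates *)

Section exponential_tail.
Context {R : realType}.

(** A discrete form of the formula expressing the mean of [max(0, X - c)] as the
    integral of the tail of [X] beyond [c]. Raising [c] to the least value [c']
    above it changes the sum by at most [(c' - c) K e^-c'], and
    [1 + (c' - c) <= exp(c' - c)] absorbs this change; the induction is on the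
    number of values above [c]. *)
Lemma sum_excess_le (I : finType) (X : I -> R) (K c : R) :
  (forall s, c <= s -> #|[set i | s <= X i]%SET|%:R <= K * expR (- s)) ->
  \sum_i Num.max 0 (X i - c) <= K * expR (- c).
Proof.
have [k] := ubnP #|[set i | c < X i]%SET|; elim: k c => // k IH c Nk tail.
have [N0|[i0 i0N]] := set_0Vmem [set i | c < X i]%SET.
  rewrite big1 => [|i _]; first by apply: le_trans (tail c (lexx _)).
  have : i \notin [set i | c < X i]%SET by rewrite N0 inE.
  by rewrite inE -leNgt => Xc; rewrite max_l// subr_le0.
have ci0 : c < X i0 by move: i0N; rewrite inE.
have [i1 cc' i1min] := @arg_minP _ _ _ i0 (fun i => c < X i) X ci0.
set c' := X i1 in cc' i1min.
have {}IH fewer := IH c' fewer (fun s c's => tail s (le_trans (ltW cc') c's)).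
have m_le : #|[set i | c < X i]%SET|%:R <= K * expR (- c').
  apply: le_trans (tail c' (ltW cc')); rewrite ler_nat subset_leq_card//.
  by apply/fintype.subsetP => i; rewrite !inE; exact: i1min.
have step : \sum_i Num.max 0 (X i - c) <=
    \sum_i ((i \in [set i | c < X i]%SET)%:R * (c' - c) + Num.max 0 (X i - c')).
  apply: ler_sum => i _; rewrite inE; case: ltP => [cX|Xc].
    by rewrite !max_r ?subr_ge0 ?i1min ?(ltW cX)// mul1r; lra.
  by rewrite !max_l ?subr_le0// ?mul0r ?addr0// (le_trans Xc)// ltW.
apply: (le_trans step); rewrite big_split/= -mulr_suml.
have -> : \sum_i (i \in [set i | c < X i]%SET)%:R =
    #|[set i | c < X i]%SET|%:R :> R.
  by rewrite -sum1_card natr_sum [RHS]big_mkcond; apply: eq_bigr => i _; case: ifP.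
have fewer : (#|[set i | (c' < X i)%R]%SET| < k)%N.
  apply: (leq_trans _ (ltnSE Nk)); apply: proper_card.
  rewrite properE; apply/andP; split.
    by apply/fintype.subsetP => i; rewrite !inE; exact: lt_trans.
  by apply/negP => /fintype.subsetP /(_ i1); rewrite !inE ltxx => /(_ cc').
have {}IH := IH fewer.
apply: (le_trans (lerD (ler_wpM2r _ m_le) IH)); first by rewrite subr_ge0 ltW.
have K0 : 0 <= K.
  by rewrite -(pmulr_lge0 _ (expR_gt0 (- c'))) (le_trans _ m_le).
have -> : expR (- c) = expR (- c') * expR (c' - c).
  by rewrite -expRD; congr expR; ring.
rewrite -mulrA -mulrDr ler_wpM2l// -[X in _ + X]mulr1 -mulrDr.
by rewrite ler_wpM2l ?expR_ge0// addrC expR_ge1Dx.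
Qed.

Lemma le_mul_expR (p c : R) : 0 <= c ->
  (forall e, 0 < e -> p <= c * expR e) -> p <= c.
Proof.
move=> c0 pc; rewrite leNgt; apply/negP => cp.
have p0 : 0 < p by exact: le_lt_trans cp.
have c1 : 0 < c.
  by rewrite lt_neqAle c0 andbT; apply/eqP => c0'; have := pc 1 ltr01;
    rewrite -c0' mul0r leNgt p0.
move: cp; apply/negP; rewrite -leNgt.
rewrite -ler_ln ?posrE//; apply/ler_addgt0Pr => e /pc.
by rewrite -ler_ln ?posrE ?mulr_gt0 ?expR_gt0// lnM ?posrE ?expR_gt0// expRK.
Qed.

End exponential_tail.

(** An exchange of coordinates between two samples is the map sending [(x, y)] to
    [(pick_tuple e x y, pick_tuple e y x)]; for fixed [x] and [y] this makes a
    function of a sample into a function on the cube. *)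
Definition pick_tuple {T : Type} {n} (e : n.-tuple bool) (x y : n.-tuple T) :
  n.-tuple T := [tuple if tnth e i then tnth x i else tnth y i | i < n].

Definition flip {n} (e : n.-tuple bool) : n.-tuple bool := map_tuple negb e.

Lemma flipK {n} : involutive (@flip n).
Proof. by move=> e; apply: eq_from_tnth => i; rewrite !tnth_map negbK. Qed.

Lemma pick_tuple_flip {T : Type} {n} (e : n.-tuple bool) (x y : n.-tuple T) :
  pick_tuple (flip e) x y = pick_tuple e y x.
Proof.
by apply: eq_from_tnth => i; rewrite !tnth_mktuple tnth_map; case: (tnth e i).
Qed.

(** In this section [G] is the supremum over [F] of the empirical sums along the
    exchanges of [x] and [y], given by its two defining properties, so that only
    real numbers occur. *)
Section swaps.
Context {R : realType} {T : Type} {n : nat}.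
Variables (F : set (T -> R)) (x y : n.-tuple T) (G : n.-tuple bool -> R).
Variable w : R.
Hypothesis G_ub : forall e f, F f ->
  \sum_i f (tnth (pick_tuple e x y) i) <= G e.
Hypothesis G_approx : forall e eta, 0 < eta ->
  exists2 f, F f & G e - eta <= \sum_i f (tnth (pick_tuple e x y) i).
Hypothesis sq_ub : forall f, F f ->
  \sum_i (f (tnth x i) - f (tnth y i)) ^+ 2 <= w.

(** Along the exchanges the empirical sum of [f] is affine in the sign vector,
    with slopes [f x_i - f y_i]. The concentration inequality on the cube applies
    to a selection of functions that are maximizing up to [eta], which then tends
    to zero. *)
Lemma sum_expR_swap_le l : 0 <= l ->
  (\sum_e expR (l * G e)) * (\sum_e expR (- (l * G e))) <=
  4 ^+ n * expR (l ^+ 2 * w / 2).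
Proof.
move=> l0; apply: le_mul_expR => [|e e0].
  by rewrite mulr_ge0 ?expR_ge0 ?exprn_ge0.
have [eta eta0 leta] : exists2 eta, 0 < eta & l * eta <= e.
  have [->|lN0] := eqVneq l 0; first by exists 1; rewrite ?mul0r// ltW.
  exists (e / l); first by rewrite divr_gt0// lt_neqAle eq_sym lN0.
  by rewrite mulrC divfK.
have /boolp.choice[fe feP] : forall d, exists f, F f /\
    G d - eta <= \sum_i f (tnth (pick_tuple d x y) i).
  by move=> d; have [f ? ?] := G_approx d _ eta0; exists f.
have := @cube_sum_expR_le R n
  (fun d i => l * (fe d (tnth x i) - fe d (tnth y i)))
  (fun d => l * \sum_i fe d (tnth (pick_tuple d x y) i))
  (fun d => l * G d).
have H : forall d d' : n.-tuple bool,
    l * \sum_i fe d (tnth (pick_tuple d x y) i) +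
    \sum_i l * (fe d (tnth x i) - fe d (tnth y i)) *
      ((tnth d' i)%:R - (tnth d i)%:R) <= l * G d'.
  move=> d d'; rewrite -(eq_bigr _ (fun i _ => mulrA l _ _)) -mulr_sumr -mulrDr.
  rewrite ler_wpM2l// -big_split/=.
  apply: le_trans (G_ub d' _ (proj1 (feP d))); apply: ler_sum => i _.
  rewrite !tnth_mktuple; case: (tnth d i); case: (tnth d' i) => /=; lra.
move=> /(_ H) cube_le.
rewrite -mulrA -expRD -ler_pdivrMr ?expR_gt0// -expRN mulrAC.
apply: le_trans cube_le; rewrite ler_wpM2r ?sumr_ge0//.
rewrite mulr_suml; apply: ler_sum => d _; rewrite -expRD ler_expR.
under [X in _ <= _ - X / 2]eq_bigr do rewrite exprMn.
rewrite -mulr_sumr.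
have [Ffe Gfe] := feP d.
have h1 := ler_wpM2l l0 Gfe.
have h2 := ler_wpM2l (sqr_ge0 l) (sq_ub _ Ffe).
rewrite mulrBr in h1; lra.
Qed.

(** The Cauchy-Schwarz inequality, in the form [r = 1 / 2] of [sum_expR_mix_le],
    separates the two vertices; flipping preserves the uniform law, so what
    remains is the previous product of exponential moments at [2 l]. *)
Lemma sum_expR_flip_le l : 0 <= l ->
  \sum_e expR (l * (G e - G (flip e))) <= 2 ^+ n * expR (l ^+ 2 * w).
Proof.
move=> l0.
pose S1 := \sum_e expR (2 * l * G e); pose S2 := \sum_e expR (- (2 * l * G e)).
have sum_gt0 (f : n.-tuple bool -> R) : 0 < \sum_e expR (f e).
  rewrite (bigD1 [tuple of nseq n true])//=.
  by rewrite ltr_wpDr ?expR_gt0// sumr_ge0// => *; exact: expR_ge0.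
have half : \sum_e expR ((1 - 2^-1) * (2 * l * G e) +
    2^-1 * (- (2 * l * G (flip e)))) <=
    1 * expR (- ((1 - 2^-1) * (- ln S1) + 2^-1 * (- ln S2))).
  apply: sum_expR_mix_le; first by apply/andP; split; lra.
    by rewrite mul1r opprK lnK// posrE sum_gt0.
  rewrite mul1r opprK lnK ?posrE ?sum_gt0// /S2.
  by rewrite [leRHS](reindex_inj (can_inj flipK)).
have S12 : S1 * S2 <= (2 ^+ n * expR (l ^+ 2 * w)) ^+ 2.
  have := sum_expR_swap_le (2 * l); rewrite mulr_ge0// => /(_ isT).
  move=> /le_trans; apply.
  have -> : (2 ^+ n * expR (l ^+ 2 * w)) ^+ 2 =
      4 ^+ n * expR (2 * (l ^+ 2 * w)) :> R.
    rewrite exprMn -expRM_natl -exprM mulnC exprM; congr (_ ^+ n * _).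
    by rewrite -natrX.
  rewrite ler_wpM2l ?exprn_ge0// ler_expR; lra.
have {}half : \sum_e expR (l * (G e - G (flip e))) <= expR ((ln S1 + ln S2) / 2).
  move: half; rewrite mul1r; congr (_ <= expR _); last by lra.
  by apply: eq_bigr => e _; congr expR; lra.
apply: (le_trans half).
rewrite -(ler_pXn2r (_ : 0 < 2)%N) ?nnegrE ?mulr_ge0 ?expR_ge0 ?exprn_ge0//.
apply: le_trans S12; rewrite -expRM_natl mulrC divfK//.
by rewrite expRD !lnK ?posrE ?sum_gt0.
Qed.

(** Chernoff's bound at [l = sqrt(s / w)], the minimizer of
    [l^2 w - 2 l sqrt(s w)]. *)
Lemma card_flip_le s : 0 < w -> 0 <= s ->
  #|[set e | s <= Num.max 0 (G e - G (flip e)) ^+ 2 / (4 * w)]%SET|%:R <=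
  2 ^+ n * expR (- s).
Proof.
move=> w0 s0.
have [q q0 qw] : exists2 q, 0 <= q & q ^+ 2 * w = s.
  exists (Num.sqrt (s / w)); first exact: sqrtr_ge0.
  by rewrite sqr_sqrtr ?divr_ge0 ?(ltW w0)// divfK ?gt_eqF.
apply: (@le_trans _ _ (\sum_e expR (q * (G e - G (flip e))) * expR (- (2 * s)))).
  rewrite -sum1_card natr_sum big_mkcond/=; apply: ler_sum => e _.
  case: ifPn => [|_]; last by rewrite mulr_ge0 ?expR_ge0.
  rewrite inE ler_pdivlMr ?mulr_gt0// -expRD => sD.
  rewrite -[leLHS]expR0 ler_expR subr_ge0.
  have D_ge : 2 * w * q <= Num.max 0 (G e - G (flip e)).
    rewrite -(ler_pXn2r (_ : 0 < 2)%N) ?nnegrE ?mulr_ge0 ?(ltW w0)// ?le_max ?lexx//.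
    by apply: le_trans sD; rewrite -qw; lra.
  have [q_eq0|qN0] := eqVneq q 0.
    by rewrite -qw q_eq0 expr0n/= mul0r mulr0 mul0r.
  have q_gt0 : 0 < q by rewrite lt_neqAle eq_sym qN0.
  have : 2 * w * q <= G e - G (flip e).
    move: D_ge; rewrite le_max => /orP[|//].
    by rewrite leNgt !mulr_gt0.
  move=> /(ler_wpM2l q0); rewrite -qw; lra.
rewrite -mulr_suml; apply: (le_trans (ler_wpM2r _ (sum_expR_flip_le q q0))).
  exact: expR_ge0.
rewrite -mulrA -expRD qw ler_wpM2l ?exprn_ge0// ler_expR; lra.
Qed.

Lemma sum_flip_excess_le c : 0 < w -> 0 <= c ->
  \sum_e Num.max 0 (Num.max 0 (G e - G (flip e)) ^+ 2 / (4 * w) - c) <=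
  2 ^+ n * expR (- c).
Proof.
move=> w0 c0; apply: sum_excess_le => s cs; apply: card_flip_le => //.
exact: le_trans cs.
Qed.

End swaps.

Local Open Scope ereal_scope.

(** * Invariance of the product law under exchanges *)

Section swap_invariance.
Context {R : realType} {d} {T : measurableType d} (mu : probability T R).

Lemma ge0_integral_power_cons n (h : n.+1.-tuple T -> \bar R) :
  measurable_fun [set: n.+1.-tuple T] h -> (forall x, 0 <= h x) ->
  \int[power_probability mu n.+1]_x h x =
  \int[mu]_a \int[power_probability mu n]_x h (tuple_cons (a, x)).
Proof.
move=> mh h0; rewrite /= ge0_integral_pushforward// preimage_setT.
by rewrite fubini_tonelli1//=; exact: measurableT_comp.
Qed.

Let cons2 n (p : T * T) (q : n.-tuple T * n.-tuple T) :=
  (tuple_cons (p.1, q.1), tuple_cons (p.2, q.2)).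

Let measurable_cons2 n : measurable_fun setT (fun pq => @cons2 n pq.1 pq.2).
Proof.
apply/measurable_fun_pair => /=.
  apply: (@measurableT_comp _ _ _ _ _ _ _ _ (fun z => (z.1.1, z.2.1))) => //.
  by apply/measurable_fun_pair => /=; apply: measurableT_comp.
apply: (@measurableT_comp _ _ _ _ _ _ _ _ (fun z => (z.1.2, z.2.2))) => //.
by apply/measurable_fun_pair => /=; apply: measurableT_comp.
Qed.

Let measurable_cons2r n p : measurable_fun setT (@cons2 n p).
Proof. exact: measurableT_comp (@measurable_cons2 n) (pair1_measurable p). Qed.

Let measurable_integral_cons2 n (h : n.+1.-tuple T * n.+1.-tuple T -> \bar R) :
  measurable_fun [set: n.+1.-tuple T * n.+1.-tuple T] h -> (forall z, 0 <= h z) ->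
  measurable_fun setT (fun p : T * T =>
    \int[power_probability mu n \x power_probability mu n]_q h (@cons2 n p q)).
Proof.
move=> mh h0.
apply: (@measurable_fun_fubini_tonelli_F _ _ _ _ _
  (power_probability mu n \x power_probability mu n : probability _ R)
  (fun pq => h (@cons2 n pq.1 pq.2))) => //.
exact: measurableT_comp mh (@measurable_cons2 n).
Qed.

(** Two applications of Tonelli's theorem bring the first coordinates of the two
    samples together, so that they can be exchanged independently of the
    others. *)
Lemma ge0_integral_power_prod_cons n
    (h : n.+1.-tuple T * n.+1.-tuple T -> \bar R) :
  measurable_fun [set: n.+1.-tuple T * n.+1.-tuple T] h -> (forall z, 0 <= h z) ->
  \int[power_probability mu n.+1 \x power_probability mu n.+1]_z h z =
  \int[mu \x mu]_p \int[power_probability mu n \x power_probability mu n]_q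
    h (@cons2 n p q).
Proof.
move=> mh h0.
have mhc := measurableT_comp mh (@measurable_cons2 n).
rewrite fubini_tonelli1// /fubini_F ge0_integral_power_cons; last 2 first.
- exact: measurable_fun_fubini_tonelli_F.
- by move=> x; exact: integral_ge0.
rewrite [RHS]fubini_tonelli1//; last 2 first.
- exact: measurable_integral_cons2.
- by move=> p; exact: integral_ge0.
apply: eq_integral => a _; rewrite /fubini_F.
pose k (xb : n.-tuple T * T) :=
  \int[power_probability mu n]_y h (@cons2 n (a, xb.2) (xb.1, y)).
transitivity (\int[power_probability mu n]_x \int[mu]_b k (x, b)).
  apply: eq_integral => x _; rewrite ge0_integral_power_cons//.
  exact: (measurableT_comp mh (pair1_measurable _)).
rewrite (fubini_tonelli k); last 2 first.
- apply: (measurable_fun_fubini_tonelli_F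
    (fun z : (n.-tuple T * T) * n.-tuple T => h (@cons2 n (a, z.1.2) (z.1.1, z.2)))).
    apply: (measurableT_comp mhc
     (g := fun z : (n.-tuple T * T) * n.-tuple T => ((a, z.1.2), (z.1.1, z.2)))).
    apply/measurable_fun_pair => /=.
      by apply/measurable_fun_pair => //=; exact: measurableT_comp.
    by apply/measurable_fun_pair => //=; exact: measurableT_comp.
  by [].
- by move=> z; exact: integral_ge0.
by apply: eq_integral => b _; rewrite [RHS]fubini_tonelli1//;
  exact: (measurableT_comp mh (@measurable_cons2r n (a, b))).
Qed.

Lemma measurable_pick_tuple n (e : n.-tuple bool) :
  measurable_fun [set: n.-tuple T * n.-tuple T]
    (fun z => pick_tuple e z.1 z.2).
Proof.
apply/measurable_fun_tnthP => i.
rewrite (_ : _ \o _ = fun z => if tnth e i then tnth z.1 i else tnth z.2 i).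
  by case: (tnth e i); apply: (measurableT_comp (measurable_tnth i)).
by apply/funext => z /=; rewrite tnth_mktuple.
Qed.

Lemma measurable_pick_tuple2 n (e : n.-tuple bool) :
  measurable_fun [set: n.-tuple T * n.-tuple T]
    (fun z => (pick_tuple e z.1 z.2, pick_tuple e z.2 z.1)).
Proof.
apply/measurable_fun_pair => /=; first exact: measurable_pick_tuple.
have := measurableT_comp (@measurable_pick_tuple _ e)
  (@measurable_swap _ _ (n.-tuple T) (n.-tuple T)).
by [].
Qed.

Lemma pick_tuple_cons n (b : bool) (e : n.-tuple bool) (a c : T)
    (x y : n.-tuple T) :
  pick_tuple [tuple of b :: e] (tuple_cons (a, x)) (tuple_cons (c, y)) =
  tuple_cons ((if b then a else c), pick_tuple e x y).
Proof.
apply: eq_from_tnth => i; rewrite !tnth_mktuple.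
by case: (unliftP ord0 i) => [j ->|->]; rewrite ?tnthS ?tnth0// tnth_mktuple.
Qed.

(** By induction on [n]: the tails are exchanged by the induction hypothesis for
    fixed first coordinates, and an exchange of the first coordinates is the
    symmetry of Tonelli's theorem. *)
Lemma ge0_integral_pick_tuple n (e : n.-tuple bool)
    (h : n.-tuple T * n.-tuple T -> \bar R) :
  measurable_fun [set: n.-tuple T * n.-tuple T] h -> (forall z, 0 <= h z) ->
  \int[power_probability mu n \x power_probability mu n]_z
    h (pick_tuple e z.1 z.2, pick_tuple e z.2 z.1) =
  \int[power_probability mu n \x power_probability mu n]_z h z.
Proof.
elim: n e h => [|n IH] e h mh h0.
  apply: eq_integral => -[x y] _; congr h; congr pair => /=;
    by rewrite [LHS]tuple0 [RHS]tuple0.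
rewrite (ge0_integral_power_prod_cons _ (fun z =>
    h (pick_tuple e z.1 z.2, pick_tuple e z.2 z.1))) => [| |z]; last 2 first.
- exact: (measurableT_comp mh (measurable_pick_tuple2 _ e)).
- exact: h0.
rewrite ge0_integral_power_prod_cons//.
case: (tupleP e) => b e'.
pose J p := \int[power_probability mu n \x power_probability mu n]_q
  h (@cons2 n p q).
have mJ : measurable_fun setT J by exact: measurable_integral_cons2.
have J0 p : 0 <= J p by exact: integral_ge0.
transitivity (\int[mu \x mu]_p J (if b then p else (p.2, p.1))).
  apply: eq_integral => p _; set p' := if b then _ else _.
  rewrite /J -(IH e' (fun q => h (@cons2 n p' q))); last 2 first.
  - exact: (measurableT_comp mh (@measurable_cons2r n p')).
  - by move=> q; exact: h0.
  by apply: eq_integral => q _; rewrite /p' /cons2/= !pick_tuple_cons; case: (b).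
rewrite -[RHS]/(\int[mu \x mu]_p J p); case: b; first by [].
have mJs := measurableT_comp mJ (@measurable_swap _ _ T T).
rewrite (fubini_tonelli1 (fun p => J (p.2, p.1)) mJs (fun=> J0 _)).
transitivity (\int[mu]_x fubini_F mu J x); last first.
  exact/esym/fubini_tonelli1.
by transitivity (\int[mu]_y fubini_G mu J y); last exact/esym/fubini_tonelli.
Qed.

End swap_invariance.

(** * Suprema of empirical sums *)

Lemma measurable_ereal_sup_image {R : realType} {d} {X : measurableType d}
    {I : Type} (F : set I) (g : I -> X -> R) :
  countable F -> (forall f, F f -> measurable_fun [set: X] (g f)) ->
  measurable_fun [set: X] (fun x => ereal_sup [set (g f x)%:E | f in F]).
Proof.
move=> /pfcard_geP[->|/unsquash h mg].
  under eq_fun do rewrite image_set0 ereal_sup0.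
  by move=> _; exact: measurable_cst.
rewrite (_ : (fun _ => _) =
    fun x => esups (fun k => (g (h k) x)%:E) 0%N); last first.
  apply/funext => x; rewrite /esups; congr ereal_sup.
  apply/seteqP; split => [_ [f Ff <-]|_ [k _ <-]].
    by have [k _ <-] := 'surj_h Ff; exists k.
  by exists (h k) => //; exact: funS.
apply: measurable_fun_esups => k; apply/measurable_EFinP; apply: mg.
exact: funS.
Qed.

Definition sqdist {R : realType} {T : Type} {n : nat} (F : set (T -> R))
    (x y : n.-tuple T) : \bar R :=
  ereal_sup [set (\sum_(i < n) (f (tnth x i) - f (tnth y i)) ^+ 2)%:E
            | f in F].

Section sup_facts.
Context {R : realType} {d} {T : measurableType d} {n : nat}.
Variable F : set (T -> R).
Implicit Types x y : n.-tuple T.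

Let Z := @sup_sum d T R F n.

Lemma sqdist_pick_tuple (e : n.-tuple bool) x y :
  sqdist F (pick_tuple e x y) (pick_tuple e y x) = sqdist F x y.
Proof.
rewrite /sqdist; congr ereal_sup; apply: eq_imagel => f _; congr EFin.
apply: eq_bigr => i _; rewrite !tnth_mktuple; case: (tnth e i) => //.
by rewrite -sqrrN opprB.
Qed.

(** With the conventions [fine +oo = 0] and [r / 0 = 0], the ratio is [0] when
    [sqdist F x y] is [0] or infinite, so that [excess] is real valued. *)
Definition excess (c : R) x y : R :=
  Num.max 0%R ((Num.max 0%R (fine (Z x) - fine (Z y)) ^+ 2)
    / (4 * fine (sqdist F x y)) - c)%R.

(** A finite [sqdist F x y] bounds [f x_i - f y_i] uniformly in [f], so the
    suprema along the exchanges are all finite or all infinite. *)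
Lemma sup_sum_pick_tuple_lty (e e' : n.-tuple bool) x y :
  sqdist F x y < +oo -> Z (pick_tuple e x y) < +oo ->
  Z (pick_tuple e' x y) < +oo.
Proof.
move=> W_lty Ze.
apply: (@le_lt_trans _ _ (Z (pick_tuple e x y) + (sqdist F x y + n%:R%:E))).
  apply: ge_ereal_sup => _ [f Ff <-].
  have h1 : (\sum_i f (tnth (pick_tuple e x y) i))%:E <= Z (pick_tuple e x y).
    by apply: ereal_sup_ubound; exists f.
  have h2 : (\sum_i (f (tnth x i) - f (tnth y i)) ^+ 2)%:E <= sqdist F x y.
    by apply: ereal_sup_ubound; exists f.
  apply: le_trans (leeD h1 (leeD h2 (lexx _))); rewrite -!EFinD lee_fin.
  have -> : n%:R = (\sum_(i < n) 1)%R :> R.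
    by rewrite sumr_const card_ord.
  rewrite -!big_split; apply: ler_sum => i _ /=; rewrite !tnth_mktuple.
  have := sqr_ge0 (f (tnth x i) - f (tnth y i) + 1).
  have := sqr_ge0 (f (tnth x i) - f (tnth y i) - 1).
  by case: (tnth e i); case: (tnth e' i); nra.
by rewrite !lte_add_pinfty// ltry.
Qed.

Lemma sqdist_ge0 x y : F !=set0 -> 0 <= sqdist F x y.
Proof.
move=> [f Ff]; apply: le_ereal_sup_tmp.
exists (\sum_i (f (tnth x i) - f (tnth y i)) ^+ 2)%:E; first by exists f.
by rewrite lee_fin sumr_ge0// => i _; exact: sqr_ge0.
Qed.

Lemma sup_sum_gtNy x : F !=set0 -> -oo < Z x.
Proof.
move=> [f Ff]; apply: (@lt_le_trans _ _ (\sum_i f (tnth x i))%:E).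
  exact: ltNyr.
by apply: ereal_sup_ubound; exists f.
Qed.

(** When [sqdist F x y] is [0] or infinite, or when the suprema along the exchanges
    are infinite, all terms vanish by the conventions in [excess]; otherwise the
    concentration result applies. *)
Lemma sum_excess_pick_tuple_le c x y : F !=set0 -> (0 <= c)%R ->
  (\sum_(e : n.-tuple bool)
    excess c (pick_tuple e x y) (pick_tuple e y x) <= 2 ^+ n * expR (- c))%R.
Proof.
move=> F0 c0.
have trivial : (forall e : n.-tuple bool,
    Num.max 0 (fine (Z (pick_tuple e x y)) - fine (Z (pick_tuple e y x))) ^+ 2
      / (4 * fine (sqdist F x y)) = 0)%R ->
  (\sum_(e : n.-tuple bool)
    excess c (pick_tuple e x y) (pick_tuple e y x) <= 2 ^+ n * expR (- c))%R.
  move=> h; rewrite big1 => [|e _]; first by rewrite mulr_ge0 ?expR_ge0 ?exprn_ge0.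
  by rewrite /excess sqdist_pick_tuple h max_l// sub0r oppr_le0.
have [W0|W0] := eqVneq (fine (sqdist F x y)) 0%R.
  by apply: trivial => e; rewrite W0 mulr0 invr0 mulr0.
have Wfin : sqdist F x y \is a fin_num.
  by move: W0; case: (sqdist F x y) => [r| |]//=; rewrite eqxx.
have W_gt0 : (0 < fine (sqdist F x y))%R.
  by rewrite lt_neqAle eq_sym W0 fine_ge0// sqdist_ge0.
have W_lty : sqdist F x y < +oo by rewrite ltey_eq Wfin.
have [[e0 Ze0]|noZ] := pselect (exists e, Z (pick_tuple e x y) < +oo); last first.
  have Zy e : Z (pick_tuple e x y) = +oo.
    apply/eqP; rewrite -leye_eq leNgt; apply/negP => Ze; apply: noZ.
    by exists e.
  apply: trivial => e.
  by rewrite -(pick_tuple_flip e x y) !Zy subrr max_l// expr0n mul0r.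
have Zfin e : Z (pick_tuple e x y) \is a fin_num.
  rewrite fin_real// sup_sum_gtNy//=.
  exact: sup_sum_pick_tuple_lty Ze0.
pose G e := fine (Z (pick_tuple e x y)).
have := @sum_flip_excess_le R T n F x y G (fine (sqdist F x y)) _ _ _ c W_gt0 c0.
rewrite /excess => H.
under eq_bigr do rewrite sqdist_pick_tuple -(pick_tuple_flip _ x y).
apply: H => [e f Ff|e eta eta0|f Ff].
- rewrite -lee_fin fineK//; by apply: ereal_sup_ubound; exists f.
- have [_ [f Ff <-] lt_f] := ub_ereal_sup_adherent eta0 (Zfin e).
  by exists f => //; rewrite -lee_fin EFinB fineK//; exact: ltW.
- by rewrite -lee_fin fineK//; apply: ereal_sup_ubound; exists f.
Qed.

End sup_facts.

Section excess_integral.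
Context {R : realType} {d} {T : measurableType d} (mu : probability T R).
Variables (n : nat) (F : set (T -> R)).
Hypothesis F_countable : countable F.
Hypothesis F_measurable : forall f, F f -> measurable_fun [set: T] f.

Let P := power_probability mu n.

Lemma measurable_sup_sum : measurable_fun [set: n.-tuple T] (@sup_sum d T R F n).
Proof.
apply: (measurable_ereal_sup_image F
  (fun f (x : n.-tuple T) => \sum_(i < n) f (tnth x i))%R) => // f Ff.
apply: measurable_sum => i.
by apply: measurableT_comp (F_measurable _ Ff) (measurable_tnth i).
Qed.

Lemma measurable_sqdist :
  measurable_fun [set: n.-tuple T * n.-tuple T] (fun z => sqdist F z.1 z.2).
Proof.
apply: (measurable_ereal_sup_image F (fun f (z : n.-tuple T * n.-tuple T) =>
  \sum_(i < n) (f (tnth z.1 i) - f (tnth z.2 i)) ^+ 2)%R) => // f Ff.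
have mf i : measurable_fun [set: n.-tuple T] (fun x => f (tnth x i)).
  by apply: measurableT_comp (F_measurable _ Ff) (measurable_tnth i).
apply: measurable_sum => i; apply: measurable_funX; apply: measurable_funB.
  exact: (measurableT_comp (mf i) measurable_fst).
exact: (measurableT_comp (mf i) measurable_snd).
Qed.

Lemma measurable_excess c : F !=set0 ->
  measurable_fun [set: n.-tuple T * n.-tuple T] (fun z => (excess F c z.1 z.2)%:E).
Proof.
move=> F0; apply/measurable_EFinP; apply: measurable_maxr => //.
apply: measurable_funB => //; apply: measurable_funM.
  apply: measurable_funX; apply: measurable_maxr => //.
  apply: measurable_funB.
    by apply: (measurableT_comp (measurableT_comp _ measurable_sup_sum)
      measurable_fst).
  by apply: (measurableT_comp (measurableT_comp _ measurable_sup_sum)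
    measurable_snd).
rewrite (_ : (fun _ => _) = fun z => (4 * fine (sqdist F z.1 z.2)) `^ (-1))%R.
  apply: (measurableT_comp (measurable_powR _)).
  apply: measurable_funM => //.
  exact: (measurableT_comp _ measurable_sqdist).
apply/funext => z; rewrite powR_inv1// mulr_ge0// fine_ge0//.
exact: sqdist_ge0.
Qed.

(** The mean over all exchanges is bounded pointwise, and each exchange preserves
    the integral. *)
Lemma integral_excess_le c : F !=set0 -> (0 <= c)%R ->
  \int[P \x P]_z (excess F c z.1 z.2)%:E <= (expR (- c))%:E.
Proof.
move=> F0 c0.
have mex := measurable_excess c F0.
have ex0 (z : n.-tuple T * n.-tuple T) : 0 <= (excess F c z.1 z.2)%:E.
  by rewrite lee_fin /excess le_max lexx.
set I := integral _ _ _.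
suff : (2 ^+ n)%:E * I <= (2 ^+ n * expR (- c))%:E.
  by rewrite EFinM lee_pmul2l// lte_fin exprn_gt0.
have -> : (2 ^+ n)%:E * I = \sum_(e : n.-tuple bool) I.
  rewrite sumr_const card_tuple card_bool -natrX; exact: mule_natl.
under eq_bigr => e _ do
  rewrite /I -(ge0_integral_pick_tuple mu n e
    (fun z => (excess F c z.1 z.2)%:E) mex ex0).
rewrite -ge0_integral_sum//=; last 2 first.
- by move=> e; exact: (measurableT_comp mex (@measurable_pick_tuple2 d T n e)).
- by move=> e z _; exact: ex0 (_, _).
apply: (@le_trans _ _ (\int[P \x P]_z (2 ^+ n * expR (- c))%:E)).
  apply: ge0_le_integral => //=.
  - by move=> z _; apply: sume_ge0 => e _; exact: ex0 (_, _).
  - apply: emeasurable_sum => e.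
    exact: (measurableT_comp mex (@measurable_pick_tuple2 d T n e)).
  - by move=> z _; rewrite sumEFin lee_fin sum_excess_pick_tuple_le.
rewrite integral_cst//=.
have -> : (P \x P) setT = 1.
  exact: (@probability_setT _ _ _ (P \x P : probability _ R)).
by rewrite mule1.
Qed.

End excess_integral.

(** * Deviations from the mean *)

Section excess_lower_bound.
Context {R : realType} {d} {T : measurableType d} {n : nat}.
Variable F : set (T -> R).
Implicit Types x y : n.-tuple T.

Lemma sqdistC x y : sqdist F x y = sqdist F y x.
Proof.
rewrite /sqdist; congr ereal_sup; apply: eq_imagel => f _; congr EFin.
by apply: eq_bigr => i _; rewrite -sqrrN opprB.
Qed.

Lemma sqdist_eq0_sup_sum x y : sqdist F x y = 0 -> sup_sum F x = sup_sum F y.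
Proof.
move=> xy0; rewrite /sup_sum; congr ereal_sup; apply: eq_imagel => f Ff.
congr EFin; apply: eq_bigr => i _.
have : (\sum_i (f (tnth x i) - f (tnth y i)) ^+ 2)%:E <= 0.
  by rewrite -xy0; apply: ereal_sup_ubound; exists f.
rewrite lee_fin => le0.
have /eqP : (\sum_i (f (tnth x i) - f (tnth y i)) ^+ 2 = 0)%R.
  by apply/eqP; rewrite eq_le le0 sumr_ge0// => j _; exact: sqr_ge0.
rewrite psumr_eq0 => [|j _]; last exact: sqr_ge0.
by move=> /allP /(_ i (mem_index_enum _)); rewrite sqrf_eq0 subr_eq0 => /eqP.
Qed.

(** The inequality [delta D - delta^2 w <= max(0, D)^2 / (4 w)], which for [w = 0]
    relies on [D = 0]. It is an inequality in the extended reals because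
    [sqdist F x y] may be infinite. *)
Lemma le_excess (delta c : R) x y : F !=set0 -> (0 < delta)%R ->
  (delta * (fine (sup_sum F x) - fine (sup_sum F y)))%:E <=
  (excess F c x y)%:E + (c%:E + (delta ^+ 2)%:E * sqdist F x y).
Proof.
move=> F0 delta0; rewrite /excess.
have := sqdist_ge0 F x y F0.
case: (sqdist F x y) (sqdist_eq0_sup_sum x y) => [w| |]// Z0 w0.
  set D := (fine (sup_sum F x) - _)%R; rewrite -EFinM -!EFinD lee_fin /=.
  rewrite lee_fin in w0.
  set M := Num.max 0%R D.
  suff DM : (delta * D - delta ^+ 2 * w <= M ^+ 2 / (4 * w))%R.
    have : (M ^+ 2 / (4 * w) - c <= Num.max 0 (M ^+ 2 / (4 * w) - c))%R.
      by rewrite le_max lexx orbT.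
    lra.
  have [w_eq0|w_neq0] := eqVneq w 0%R.
    have -> : D = 0%R by rewrite /D Z0 ?w_eq0// subrr.
    by rewrite w_eq0 !mulr0 subrr invr0 mulr0.
  have w_gt0 : (0 < w)%R by rewrite lt_neqAle eq_sym w_neq0.
  rewrite ler_pdivlMr ?mulr_gt0//.
  have DM : (D <= M)%R by rewrite /M le_max lexx orbT.
  have := sqr_ge0 (M - 2 * w * delta)%R.
  have := mulr_ge0 (ltW w_gt0) (mulr_ge0 (ltW delta0) (eqbRL (subr_ge0 _ _) DM)).
  lra.
rewrite gt0_muley ?lte_fin ?exprn_gt0// addey//.
exact: leey.
Qed.

End excess_lower_bound.

Section probability_facts.
Context {R : realType} {d} {X : measurableType d} (P : probability X R).

Lemma le_integral_ge0 (f g : X -> \bar R) :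
  measurable_fun setT f -> measurable_fun setT g -> (forall x, 0 <= g x) ->
  (forall x, f x <= g x) -> \int[P]_x f x <= \int[P]_x g x.
Proof.
move=> mf mg g0 fg; rewrite integralE.
apply: (@le_trans _ _ (\int[P]_x (f^\+ x))).
  by rewrite -[leRHS]sube0 leeB// integral_ge0.
apply: ge0_le_integral => //; first exact: measurable_funepos.
by move=> x _; rewrite funeposE ge_max fg g0.
Qed.

(** Integrating the pointwise inequality gives [delta u <= E h + c + delta^2 v].
    This holds also when [E h] is infinite, because the right-hand side of the
    pointwise inequality is nonnegative. *)
Lemma one_le_integral (D : X -> R) (h W : X -> \bar R) (delta c u v : R) :
  P.-integrable setT (EFin \o D) -> \int[P]_y (D y)%:E = u%:E ->
  measurable_fun setT h -> (forall y, 0 <= h y) ->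
  measurable_fun setT W -> (forall y, 0 <= W y) -> \int[P]_y W y = v%:E ->
  (0 <= c)%R ->
  (forall y, (delta * D y)%:E <= h y + (c%:E + (delta ^+ 2)%:E * W y)) ->
  (c + 1 <= delta * u - delta ^+ 2 * v)%R ->
  1 <= \int[P]_y h y.
Proof.
move=> iD uE mh h0 mW W0 vE c0 Dle cuv.
have mD := measurable_int P iD.
have mdW : measurable_fun setT (fun y => (delta ^+ 2)%:E * W y).
  exact: measurable_funeM.
have dW0 y : 0 <= (delta ^+ 2)%:E * W y by rewrite mule_ge0// lee_fin sqr_ge0.
have : \int[P]_y (delta * D y)%:E <=
    \int[P]_y (h y + (c%:E + (delta ^+ 2)%:E * W y)).
  apply: le_integral_ge0 => //.
  - by under eq_fun do rewrite EFinM; exact: measurable_funeM.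
  - by apply: emeasurable_funD => //; apply: emeasurable_funD.
  - by move=> y; rewrite !adde_ge0// lee_fin.
under eq_integral do rewrite EFinM.
rewrite integralZl// uE ge0_integralD//; last 2 first.
- by move=> y _; rewrite adde_ge0// lee_fin.
- exact: emeasurable_funD.
rewrite ge0_integralD//.
rewrite ge0_integralZl//; last by rewrite lee_fin sqr_ge0.
rewrite vE integral_cst//= probability_setT mule1 -!EFinM -!EFinD.
have : 0 <= \int[P]_y h y by exact: integral_ge0.
case: (\int[P]_y h y) => [r _|_ _|//]; last exact: leey.
by rewrite -EFinD !lee_fin; lra.
Qed.

Lemma probability_le_integral2 (E : set X) (h : X * X -> \bar R) :
  measurable E -> measurable_fun setT h -> (forall z, 0 <= h z) ->
  {ae P, forall x, E x -> 1 <= \int[P]_y h (x, y)} ->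
  P E <= \int[P \x P]_z h z.
Proof.
move=> mE mh h0 Eh.
rewrite fubini_tonelli1// -[E]setIT -integral_indic//.
apply: ae_ge0_le_integral => //.
- by apply/measurable_EFinP; exact: measurable_indic.
- by move=> ? _; exact: integral_ge0.
- exact: measurable_fun_fubini_tonelli_F.
- apply: filterS Eh => x Ex _; rewrite indicE.
  have [xE|_] := boolP (x \in E); last exact: integral_ge0.
  by apply: Ex; rewrite inE in xE.
Qed.

End probability_facts.

(** The maximizer [u / (2 v)] of [delta u - delta^2 v] gives the value
    [u^2 / (4 v)]; when [v = 0] the expression is linear in [delta] with a
    positive slope. *)
Lemma exists_deviation_scale {R : realType} (u v t : R) :
  (0 <= v)%R -> (0 < t)%R -> (2 * Num.sqrt (v * t) <= u)%R ->
  (v = 0 -> u <> 0)%R ->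
  exists2 delta : R, (0 < delta)%R & (t <= delta * u - delta ^+ 2 * v)%R.
Proof.
move=> v0 t0 ut vu.
have u0 : (0 <= u)%R by apply: le_trans ut; rewrite mulr_ge0 ?sqrtr_ge0.
have [v_eq0|v_neq0] := eqVneq v 0%R.
  have u_gt0 : (0 < u)%R by rewrite lt_neqAle u0 andbT eq_sym; apply/eqP/vu.
  exists (t / u)%R; first exact: divr_gt0.
  by rewrite v_eq0 mulr0 subr0 divfK// gt_eqF.
have v_gt0 : (0 < v)%R by rewrite lt_neqAle eq_sym v_neq0.
have u_gt0 : (0 < u)%R.
  by apply: lt_le_trans ut; rewrite mulr_gt0// sqrtr_gt0 mulr_gt0.
exists (u / (2 * v))%R; first by rewrite divr_gt0 ?mulr_gt0.
have -> : (u / (2 * v) * u - (u / (2 * v)) ^+ 2 * v = u ^+ 2 / (4 * v))%R.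
  by field; rewrite gt_eqF.
rewrite ler_pdivlMr ?mulr_gt0//.
have sq : (Num.sqrt (v * t) ^+ 2 = v * t)%R.
  by rewrite sqr_sqrtr// mulr_ge0// ltW.
have : ((2 * Num.sqrt (v * t)) ^+ 2 <= u ^+ 2)%R.
  by rewrite ler_sqr ?nnegrE ?mulr_ge0 ?sqrtr_ge0.
rewrite exprMn sq; lra.
Qed.

Section deviation.
Context {R : realType} {d} {T : measurableType d} (mu : probability T R).
Variables (n : nat) (F : set (T -> R)).
Hypothesis F_countable : countable F.
Hypothesis F_measurable : forall f, F f -> measurable_fun [set: T] f.

Let P := power_probability mu n.
Let Z := @sup_sum d T R F n.
Let V := @cond_var d T R mu F n.
Let EZ := \int[P]_x Z x.

Hypothesis Z_integrable : P.-integrable setT Z.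

Let F_neq0 : F !=set0.
Proof.
apply/set0P/negP => /eqP F0; have := integrable_fin_num measurableT Z_integrable.
rewrite (_ : Z = cst -oo); last first.
  by apply/funext => x; rewrite /Z /sup_sum F0 image_set0 ereal_sup0.
by rewrite integral_cst//= probability_setT mule1.
Qed.

Let EZ_fin : EZ \is a fin_num.
Proof. exact: integrable_fin_num. Qed.

Let mZ : measurable_fun setT Z. Proof. exact: measurable_int Z_integrable. Qed.

Let z (x : n.-tuple T) : R := fine (Z x).

Let z_ae : ae_eq P setT (EFin \o z) Z.
Proof.
apply: filterS (integrable_ae measurableT Z_integrable) => x /(_ I) Zx _.
by rewrite /= fineK.
Qed.

Let mz : measurable_fun setT (EFin \o z).
Proof. by apply/measurable_EFinP; exact: measurableT_comp. Qed.

Let integrable_z : P.-integrable setT (EFin \o z).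
Proof.
apply: le_integrable Z_integrable => // x _.
by rewrite /= /z; case: (Z x) => [r| |]//=; rewrite normr0 leey.
Qed.

Let integral_z : \int[P]_x (z x)%:E = (fine EZ)%:E.
Proof. by rewrite fineK//; exact: ae_eq_integral. Qed.

Let mV : measurable_fun setT V.
Proof.
apply: (measurable_fun_fubini_tonelli_F (fun z => sqdist F z.1 z.2)).
  exact: measurable_sqdist.
by move=> ?; exact: sqdist_ge0.
Qed.

Let V_ge0 x : 0 <= V x.
Proof. by apply: integral_ge0 => y _; exact: sqdist_ge0. Qed.

(** An infinite [V x] is excluded by the first inequality, since [u] is finite. *)
Let V_scale x (u t : R) : (0 < t)%R ->
  2%:E * (V x * t%:E) `^ 2^-1 <= u%:E -> (V x = 0 -> u <> 0%R) ->
  exists2 v : R, V x = v%:E &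
    exists2 delta : R, (0 < delta)%R & (t <= delta * u - delta ^+ 2 * v)%R.
Proof.
move=> t0; have := V_ge0 x; case: (V x) => [v| |]// v0.
  rewrite lee_fin in v0.
  rewrite -(EFinM v t) poweR_EFin -EFinM lee_fin powR12_sqrt ?mulr_ge0 ?(ltW t0)//.
  move=> vtu v_neq0; exists v => //; apply: exists_deviation_scale => //.
  by move=> v_eq0; apply: v_neq0; rewrite v_eq0.
rewrite gt0_mulye// poweRyr ?invr_neq0//.
by rewrite gt0_muley ?lte_fin// leye_eq.
Qed.

Let measurable_threshold t : measurable_fun setT
  (fun x => 2%:E * (V x * t%:E) `^ 2^-1).
Proof.
apply: measurable_funeM; apply: (measurableT_comp (measurable_poweR _)).
by apply: emeasurable_funM.
Qed.

Let measurable_degenerate : measurable [set x | V x = 0 /\ Z x = EZ].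
Proof.
rewrite (_ : [set _ | _] = V @^-1` [set 0] `&` Z @^-1` [set EZ])//.
by apply: measurableI; rewrite -[X in measurable X]setTI;
  [exact: mV | exact: mZ].
Qed.

Lemma measurable_upper_deviation t :
  measurable ([set x | Z x >= EZ + 2%:E * (V x * t%:E) `^ (2^-1)]
       `\` [set x | V x = 0 /\ Z x = EZ]).
Proof.
apply: measurableD => //; rewrite -[X in measurable X]setTI.
by apply: measurable_fun_lee => //; exact: emeasurable_funD.
Qed.

Lemma measurable_lower_deviation t :
  measurable ([set x | Z x <= EZ - 2%:E * (V x * t%:E) `^ (2^-1)]
       `\` [set x | V x = 0 /\ Z x = EZ]).
Proof.
apply: measurableD => //; rewrite -[X in measurable X]setTI.
by apply: measurable_fun_lee => //; exact: emeasurable_funB.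
Qed.

Let mexcess1 c (x : n.-tuple T) : measurable_fun setT (fun y => (excess F c x y)%:E).
Proof.
exact: (measurableT_comp (measurable_excess n F F_countable F_measurable c F_neq0)
  (pair1_measurable x)).
Qed.

Let mexcess2 c (x : n.-tuple T) : measurable_fun setT (fun y => (excess F c y x)%:E).
Proof.
exact: (measurableT_comp (measurable_excess n F F_countable F_measurable c F_neq0)
  (pair2_measurable x)).
Qed.

Let msqdist (x : n.-tuple T) :
  measurable_fun setT (sqdist F x : n.-tuple T -> \bar R).
Proof.
exact: (measurableT_comp (measurable_sqdist n F F_countable F_measurable)
  (pair1_measurable x)).
Qed.

Let excess_ge0 c (x y : n.-tuple T) : 0 <= (excess F c x y)%:E.
Proof. by rewrite lee_fin /excess le_max lexx. Qed.

Lemma upper_deviation_le t : (1 <= t)%R ->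
  P ([set x | Z x >= EZ + 2%:E * (V x * t%:E) `^ (2^-1)]
       `\` [set x | V x = 0 /\ Z x = EZ]) <= (expR (1 - t))%:E.
Proof.
move=> t1; rewrite -[(1 - t)%R]opprB.
have c0 : (0 <= t - 1)%R by rewrite subr_ge0.
apply: le_trans
  (integral_excess_le mu n F F_countable F_measurable (t - 1)%R F_neq0 c0).
apply: probability_le_integral2 => //.
- exact: measurable_upper_deviation.
- exact: measurable_excess.
apply: filterS (integrable_ae measurableT Z_integrable) => x /(_ I) Zx [/= xE xN].
have zx : Z x = (z x)%:E by rewrite fineK.
have dev : 2%:E * (V x * t%:E) `^ 2^-1 <= (z x - fine EZ)%:E.
  by rewrite EFinB -zx fineK// leeBrDl.
have ndeg : V x = 0 -> (z x - fine EZ)%R <> 0%R.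
  move=> Vx0 /eqP; rewrite subr_eq0 => /eqP zm; apply: xN; split=> //.
  by rewrite zx zm fineK.
have [v Vv [delta delta0 dt]] := V_scale x _ t (lt_le_trans ltr01 t1) dev ndeg.
apply: (@one_le_integral _ _ _ P (fun y => z x - z y)%R _ (sqdist F x) delta
  (t - 1)%R (z x - fine EZ)%R v) => //.
- apply: (eq_integrable measurableT (cst (z x)%:E \- (EFin \o z))) => //.
  by apply: integrableB => //; exact: finite_measure_integrable_cst.
- under eq_integral do rewrite EFinB.
  rewrite integralB//; last exact: finite_measure_integrable_cst.
  by rewrite integral_z integral_cst//= probability_setT mule1 EFinB.
- by move=> y; exact: sqdist_ge0.
- by move=> y; exact: le_excess.
- by rewrite subrK.
Qed.

Lemma lower_deviation_le t : (1 <= t)%R ->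
  P ([set x | Z x <= EZ - 2%:E * (V x * t%:E) `^ (2^-1)]
       `\` [set x | V x = 0 /\ Z x = EZ]) <= (expR (1 - t))%:E.
Proof.
move=> t1; rewrite -[(1 - t)%R]opprB.
have c0 : (0 <= t - 1)%R by rewrite subr_ge0.
have mex := measurable_excess n F F_countable F_measurable (t - 1)%R F_neq0.
apply: le_trans
  (integral_excess_le mu n F F_countable F_measurable (t - 1)%R F_neq0 c0).
(* The sign vector with all entries false exchanges x and y. *)
rewrite -(ge0_integral_pick_tuple mu n [tuple of nseq n false]
  (fun z => (excess F (t - 1)%R z.1 z.2)%:E))//=.
have pickE (x y : n.-tuple T) : pick_tuple [tuple of nseq n false] x y = y.
  by apply: eq_from_tnth => i; rewrite tnth_mktuple tnth_nseq.
under eq_integral do rewrite !pickE.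
apply: (probability_le_integral2 P _
  (fun z : n.-tuple T * n.-tuple T => (excess F (t - 1)%R z.2 z.1)%:E)) => //.
- exact: measurable_lower_deviation.
- exact: (measurableT_comp mex (@measurable_swap _ _ (n.-tuple T) (n.-tuple T))).
apply: filterS (integrable_ae measurableT Z_integrable) => x /(_ I) Zx [/= xE xN].
have zx : Z x = (z x)%:E by rewrite fineK.
have dev : 2%:E * (V x * t%:E) `^ 2^-1 <= (fine EZ - z x)%:E.
  move: xE; rewrite EFinB -zx fineK//.
  case: (_ `^ _) => [r| |]; rewrite -[Z x]fineK// -[EZ]fineK//.
  - by rewrite -!EFinM -!EFinB !lee_fin; lra.
  - by rewrite gt0_muley.
  - by rewrite gt0_muleNy// leNye.
have ndeg : V x = 0 -> (fine EZ - z x)%R <> 0%R.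
  move=> Vx0 /eqP; rewrite subr_eq0 => /eqP zm; apply: xN; split=> //.
  by rewrite zx -zm fineK.
have [v Vv [delta delta0 dt]] := V_scale x _ t (lt_le_trans ltr01 t1) dev ndeg.
apply: (@one_le_integral _ _ _ P (fun y => z y - z x)%R _ (sqdist F x) delta
  (t - 1)%R (fine EZ - z x)%R v) => //.
- apply: (eq_integrable measurableT ((EFin \o z) \- cst (z x)%:E)) => //.
  by apply: integrableB => //; exact: finite_measure_integrable_cst.
- under eq_integral do rewrite EFinB.
  rewrite integralB//; last exact: finite_measure_integrable_cst.
  by rewrite integral_z integral_cst//= probability_setT mule1 EFinB.
- by move=> y; exact: sqdist_ge0.
- by move=> y; rewrite sqdistC; exact: le_excess.
- by rewrite subrK.
Qed.

End deviation.

Lemma expR_le_bound {R : realType} (alpha t : R) : (0 < alpha)%R -> (0 <= t)%R ->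
  (expR (1 - t) <= 2 `^ (alpha + 1) * expR (1 - alpha / (alpha + 1) * t))%R.
Proof.
move=> a0 t0; have a1 : (0 < alpha + 1)%R by rewrite addr_gt0.
apply: (@le_trans _ _ (1 * expR (1 - alpha / (alpha + 1) * t))%R).
  rewrite mul1r ler_expR lerB// -[leRHS]mul1r ler_wpM2r//.
  by rewrite ler_pdivrMr// mul1r lerDl.
rewrite ler_wpM2r ?expR_ge0// -[leLHS](powRr0 2) ler_powR//.
  by rewrite ler1n.
exact: ltW.
Qed.

(* The degenerate points with V x = 0 and Z x = EZ are removed from both events:
   when F = [set cst 0] they are the whole space, and the events would have
   probability 1 for every t. *)
Theorem theorem1 (R : realType) (d : measure_display) (Omega : measurableType d)
    (mu : probability Omega R) (n : nat) (n_ge1 : (1 <= n)%N)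
    (F : set (Omega -> R)) (F_countable : countable F)
    (F_measurable : forall f, F f -> measurable_fun [set: Omega] f)
    (sup_integrable :
       (power_probability mu n).-integrable [set: n.-tuple Omega]
         (sup_sum F (n := n)))
    (alpha t : R) (alpha_gt0 : (0 < alpha)%R) (t_ge0 : (0 <= t)%R) :
  let P := power_probability mu n in
  let Z := sup_sum F (n := n) in
  let V := cond_var mu F (n := n) in
  let EZ := \int[P]_x Z x in
  let bound := (2 `^ (alpha + 1) * expR (1 - alpha / (alpha + 1) * t))%R in
  P ([set x | Z x >= EZ + 2%:E * (V x * t%:E) `^ (2^-1)]
       `\` [set x | V x = 0 /\ Z x = EZ]) <= bound%:E /\
  P ([set x | Z x <= EZ - 2%:E * (V x * t%:E) `^ (2^-1)]
       `\` [set x | V x = 0 /\ Z x = EZ]) <= bound%:E.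
Proof.
move=> P Z V EZ bound.
have small E : measurable E -> (t < 1)%R -> P E <= (expR (1 - t))%:E.
  move=> mE t1; apply: (@le_trans _ _ 1); first exact: probability_le1.
  by rewrite lee_fin -[leLHS]expR0 ler_expR subr_ge0 ltW.
have e_le_bound : (expR (1 - t))%:E <= bound%:E.
  by rewrite lee_fin; exact: expR_le_bound.
have [t1|t1] := leP 1%R t; split; apply: le_trans e_le_bound.
- exact: upper_deviation_le.
- exact: lower_deviation_le.
- by apply: small => //; exact: measurable_upper_deviation.
- by apply: small => //; exact: measurable_lower_deviation.
Qed.
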